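(* Let $\mathfrak M$ be a model of $\mathrm{BHS}$ satisfying the finite-interpolation scheme $\mathrm{FI}$. Fix $U\in\tau_0$, a compact set $K\Subset U$, $m\ge1$, $\delta>0$, and $R>0$. Then, uniformly for $\bar x\in\Gamma_{K,m,\delta}$, $$\{\bar r\in\mathbb R^m:q_{U,\bar x}(\bar r)<R\}\subseteq E_{U,R}(\bar x)\subseteq\{\bar r\in\mathbb R^m:q_{U,\bar x}(\bar r)\le R\},$$ and the closure of $E_{U,R}(\bar x)$ in $\mathbb R^m$ is exactly $\{\bar r:q_{U,\bar x}(\bar r)\le R\}$. Consequently, every quantifier ($\inf$ or $\sup$) over $H_R(U)$ in a formula of the finite-evaluation fragment is uniformly eliminable on $\Gamma_{K,m,\delta}$ in the definitional presentation generated by the predicates $q_{U,\bar x}$: the predicate resulting from the quantifier is a uniform limit of finite continuous combinations of instances of $q$, point data, and the original evaluation data.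
   Context: $(X,\tau)$ is a nonempty, locally compact, locally connected Hausdorff space, and $H$ is a sheaf on it whose sections $h\in H(U)$ are continuous real-valued functions on $U$ forming a linear space (harmonic functions). A relatively compact open $U$ is regular if for every $g\in C(\partial U)$ there is a unique $h\in H(U)$ such that $h\to g(y)$ along every ultrafilter on $U$ converging to $y$, for every $y\in\partial U$, and $h\ge0$ whenever $g\ge0$; write $h=D_U(g)$. A regular basis $\tau_0$ is a base of $\tau$ consisting of relatively compact regular open sets. The monotone convergence principle says that for an increasing sequence of harmonic functions on a connected $U\in\tau_0$, the pointwise supremum is harmonic or identically $+\infty$. A Brelot harmonic space is a harmonic sheaf with a regular basis and the monotone convergence principle. The unbounded many-sorted continuous first-order language $\mathcal L_{\mathrm{Har}}$ has a gauged metric point sort $(X,d_X,\nu_X)$ and, for $U\in\tau_0$: a gauged metric domain sort $(X_U,d_U,\nu_U)$ (with $X_U$ the points of $U$), gauged metric linear sorts $H(U)$ (with metric $d_{H(U)}$ and gauge $\nu_{H(U)}$) and $B(U)$ (intended to be $C(\partial U)$), maps $i_U:X_U\to X$, $D_U:B(U)\to H(U)$, the predicate $\operatorname{Eval}_U(x,h)=h(x)$, and for $V\subseteq U$ inclusions $j_{V,U}:X_V\to X_U$ and restrictions $\rho_{V,U}:H(U)\to H(V)$. The theory $\mathrm{BHS}$ consists of the compatibility axioms ($j_{U,U}=\mathrm{id}$; $\operatorname{Eval}_V(x,\rho_{V,U}(h))=\operatorname{Eval}_U(j_{V,U}(x),h)$; $i_U\circ j_{V,U}=i_V$; $j_{W,U}=j_{V,U}\circ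 j_{W,V}$; linearity of $\operatorname{Eval}_U$ in $h$), the sheaf axioms, the regular-basis axiom and the monotone-convergence scheme. Conventions: $\nu_{H(U)}$ is absolutely homogeneous and subadditive; on bounded loci $\operatorname{Eval}_U$ is uniformly continuous, i.e. for compact $K\Subset U$ it is uniformly continuous on $K\times\{h:\nu_{H(U)}(h)\le R\}$, and there is $B_{U,K}>0$ with $|\operatorname{Eval}_U(x,h)|\le B_{U,K}\,\nu_{H(U)}(h)$ for $x\in K$. All predicates and connectives are uniformly continuous on bounded loci. For $\bar x=(x_1,\dots,x_m)\in U^m$ put $\operatorname{ev}_{\bar x}(h)=(h(x_1),\dots,h(x_m))$. $\mathrm{FI}$ is the scheme: for all $U\in\tau_0$, $m\ge1$ and pairwise distinct $x_1,\dots,x_m\in U$, the map $\operatorname{ev}_{\bar x}:H(U)\to\mathbb R^m$ is surjective. For compact $K\Subset U$ and $\delta>0$, $\Gamma_{K,m,\delta}=\{\bar x\in K^m:\min_{i<j}d_U(x_i,x_j)\ge\delta\}$. The minimal interpolation gauge is $q_{U,\bar x}(\bar r)=\inf\{\nu_{H(U)}(h):h\in H(U),\ \operatorname{ev}_{\bar x}(h)=\bar r\}$. Put $H_R(U)=\{h\in H(U):\nu_{H(U)}(h)\le R\}$ and $E_{U,R}(\bar x)=\operatorname{ev}_{\bar x}(H_R(U))$. Numerical tuples $\bar r$ are metalinguistic: in a formula they occur only as constants in continuous connectives or as slots into which real-valued formula outputs are substituted (there is no scalar quantifier). A formula belongs to the finite evaluation fragment if each quantified harmonic variable occurs only through finitely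 many predicates $\operatorname{Eval}_U(x_i,h)$ and through the gauge bound on its quantifier. Thus a single quantified subformula has the form $\inf_{h\in H_R(U)}\Phi(\bar z,\operatorname{ev}_{\bar x}(h))$ (or with $\sup$), with $\Phi$ uniformly continuous in its $m$ real slots on bounded loci and with the parameters $\bar z$ ranging in a bounded locus. *)

(* Defs.v *)
From HB Require Import structures.
From mathcomp Require Import all_boot all_order all_algebra.
From mathcomp Require Import all_classical all_reals all_analysis.
Import Order.TTheory GRing.Theory Num.Theory.
Import numFieldNormedType.Exports.

Set Implicit Arguments.
Unset Strict Implicit.
Unset Printing Implicit Defensive.

Local Open Scope classical_set_scope.
Local Open Scope ring_scope.

Record gauged_metric (R : realType) (T : Type) := GaugedMetric {
  gdist : T -> T -> R;
  gauge : T -> R;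
  gdist_eq0 : forall x y, gdist x y = 0 <-> x = y;
  gdist_sym : forall x y, gdist x y = gdist y x;
  gdist_triangle : forall x y z, gdist x z <= gdist x y + gdist y z;
  gauge_ge0 : forall x, 0 <= gauge x;
  gauge_unif_cont : forall b e : R, 0 < e -> exists2 d : R, 0 < d &
    forall x y, gauge x <= b -> gauge y <= b -> gdist x y < d ->
      `|gauge x - gauge y| < e
}.

(* The raw data interpreting the language: the space, the family tau0 indexing
   the sorts, the sorts themselves and the function and predicate symbols.
   [bval] reads an element of the sort B(U) as a function on the boundary of U;
   its values outside the boundary are irrelevant. *)
Record har_structure (R : realType) := HarStructure {
  hspace : topologicalType;
  tau0 : set (set hspace);
  pt_gm : gauged_metric R hspace;
  dom : {U : set hspace | tau0 U} -> Type;
  dom_gm : forall U, gauged_metric R (dom U);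
  har : {U : set hspace | tau0 U} -> lmodType R;
  har_gm : forall U, gauged_metric R (har U);
  bdr : {U : set hspace | tau0 U} -> lmodType R;
  bdr_gm : forall U, gauged_metric R (bdr U);
  bval : forall U, bdr U -> hspace -> R;
  inX : forall U, dom U -> hspace;
  dirichlet : forall U, bdr U -> har U;
  Eval : forall U, dom U -> har U -> R;
  dincl : forall V U : {U : set hspace | tau0 U},
    (sval V `<=` sval U) -> dom V -> dom U;
  hrestr : forall V U : {U : set hspace | tau0 U},
    (sval V `<=` sval U) -> har U -> har V
}.

Notation idx M := {U : set (hspace M) | tau0 U}.

Section BrelotHarmonicSpaces.
Variables (R : realType) (M : har_structure R).
Implicit Types U V W : idx M.

Definition locally_connected (T : topologicalType) :=
  forall (x : T) (A : set T), nbhs x A ->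
    exists V : set T, [/\ open V, connected V, V x & V `<=` A].

Definition base_space_axioms :=
  [/\ [set: hspace M] !=set0, hausdorff_space (hspace M),
      locally_compact [set: hspace M] & locally_connected (hspace M)].

(* The domain sort X_U consists of the points of U, and d_U metrizes the
   topology that U inherits from the space (U is open, so neighbourhoods in U
   are neighbourhoods in the space). *)
Definition domain_sort_axioms := forall U,
  [/\ injective (@inX R M U), range (@inX R M U) = sval U &
      forall (x : dom U) (A : set (hspace M)),
        nbhs (inX x) A <->
        exists2 e : R, 0 < e &
          forall y : dom U, gdist (dom_gm U) x y < e -> A (inX y)].

Definition harmonic_gauge_axioms := forall U,
  (forall (a : R) (h : har U),
     gauge (har_gm U) (a *: h) = `|a| * gauge (har_gm U) h) /\
  (forall h k : har U,
     gauge (har_gm U) (h + k) <= gauge (har_gm U) h + gauge (har_gm U) k).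

Definition compatibility_axioms :=
  [/\ forall U (p : sval U `<=` sval U) (x : dom U), dincl p x = x,
      forall V U (p : sval V `<=` sval U) (x : dom V) (h : har U),
        Eval x (hrestr p h) = Eval (dincl p x) h,
      forall V U (p : sval V `<=` sval U) (x : dom V),
        inX (dincl p x) = inX x,
      forall W V U (p : sval W `<=` sval V) (q : sval V `<=` sval U)
          (r : sval W `<=` sval U) (x : dom W),
        dincl r x = dincl q (dincl p x) &
      forall U (x : dom U) (a : R) (h k : har U),
        Eval x (a *: h + k) = a * Eval x h + Eval x k].

(* Sections are continuous functions (hence determined by their values), and
   they form a sheaf on the base tau0; sections over a cover are compatible
   when they agree on every basic set contained in an overlap. *)
Definition sheaf_axioms :=
  [/\ forall U (h : har U) (x : dom U) (e : R), 0 < e ->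
        exists2 A, nbhs (inX x) A &
          forall y : dom U, A (inX y) -> `|Eval x h - Eval y h| < e,
      forall U (h k : har U), (forall x : dom U, Eval x h = Eval x k) -> h = k,
      forall U (I : Type) (V : I -> idx M)
          (p : forall i, sval (V i) `<=` sval U),
        sval U = \bigcup_i sval (V i) ->
        forall h k : har U,
          (forall i, hrestr (p i) h = hrestr (p i) k) -> h = k &
      forall U (I : Type) (V : I -> idx M)
          (p : forall i, sval (V i) `<=` sval U) (s : forall i, har (V i)),
        sval U = \bigcup_i sval (V i) ->
        (forall i j W (qi : sval W `<=` sval (V i))
            (qj : sval W `<=` sval (V j)),
          hrestr qi (s i) = hrestr qj (s j)) ->
        exists h : har U, forall i, hrestr (p i) h = s i].

Definition boundary (T : topologicalType) (A : set T) := closure A `\` A°.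

Definition has_boundary_values U (g : hspace M -> R) (h : har U) :=
  forall (F : set_system (dom U)) (y : hspace M), UltraFilter F ->
    boundary (sval U) y -> @inX R M U @ F --> y ->
    (fun x : dom U => Eval x h) @ F --> g y.

Definition regular U :=
  [/\ open (sval U), compact (closure (sval U)) &
      forall g : hspace M -> R, {within boundary (sval U), continuous g} ->
        (exists! h : har U, has_boundary_values g h) /\
        forall h : har U, has_boundary_values g h ->
          (forall y, boundary (sval U) y -> 0 <= g y) ->
          forall x : dom U, 0 <= Eval x h].

(* B(U) is the space of continuous functions on the boundary of U, and
   D_U solves the Dirichlet problem. *)
Definition boundary_sort_axioms := forall U,
  [/\ forall b : bdr U, {within boundary (sval U), continuous (bval b)},
      forall g : hspace M -> R, {within boundary (sval U), continuous g} ->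
        exists b : bdr U, forall y, boundary (sval U) y -> bval b y = g y,
      forall b c : bdr U,
        (forall y, boundary (sval U) y -> bval b y = bval c y) -> b = c,
      forall (a : R) (b c : bdr U) y, boundary (sval U) y ->
        bval (a *: b + c) y = a * bval b y + bval c y &
      forall b : bdr U, has_boundary_values (bval b) (dirichlet b)].

Definition regular_basis_axiom :=
  [/\ basis (@tau0 R M), forall U, regular U & boundary_sort_axioms].

Definition monotone_convergence_principle :=
  forall U, connected (sval U) -> forall h : nat -> har U,
    (forall n (x : dom U), Eval x (h n) <= Eval x (h n.+1)) ->
    (exists k : har U, forall x : dom U,
       ereal_sup (range (fun n => (Eval x (h n))%:E)) = (Eval x k)%:E) \/
    (forall x : dom U, ereal_sup (range (fun n => (Eval x (h n))%:E)) = +oo%E).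

Definition is_BHS_model :=
  [/\ base_space_axioms, domain_sort_axioms, harmonic_gauge_axioms,
      compatibility_axioms &
      [/\ sheaf_axioms, regular_basis_axiom & monotone_convergence_principle]].

Definition eval_uniform_on U (K : set (hspace M)) :=
  (forall b e : R, 0 < e -> exists2 d : R, 0 < d &
     forall (x y : dom U) (h k : har U), K (inX x) -> K (inX y) ->
       gauge (har_gm U) h <= b -> gauge (har_gm U) k <= b ->
       gdist (dom_gm U) x y < d -> gdist (har_gm U) h k < d ->
       `|Eval x h - Eval y k| < e) /\
  (exists2 B : R, 0 < B & forall (x : dom U) (h : har U), K (inX x) ->
     `|Eval x h| <= B * gauge (har_gm U) h).

Definition ev U m (x : 'I_m -> dom U) (h : har U) : 'rV[R]_m :=
  \row_i Eval (x i) h.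

Definition finite_interpolation := forall U m (x : 'I_m -> dom U),
  (0 < m)%N -> injective x -> forall r : 'rV[R]_m, exists h, ev x h = r.

Definition separated_tuples U (K : set (hspace M)) m (d : R) :
    set ('I_m -> dom U) :=
  [set x | (forall i, K (inX (x i))) /\
           (forall i j : 'I_m, (i < j)%N -> d <= gdist (dom_gm U) (x i) (x j))].

Definition har_ball U (rho : R) : set (har U) :=
  [set h | gauge (har_gm U) h <= rho].

(* [inf] takes the junk value 0 when no h interpolates r, which cannot happen
   at pairwise distinct points under finite interpolation. *)
Definition interp_gauge U m (x : 'I_m -> dom U) (r : 'rV[R]_m) : R :=
  inf [set gauge (har_gm U) h | h in [set h | ev x h = r]].

Definition eval_set U m (rho : R) (x : 'I_m -> dom U) : set 'rV[R]_m :=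
  ev x @` @har_ball U rho.

(* Contexts are lists of sorts; variables are typed de Bruijn indices. *)
Inductive lsort := Pt | Dom of idx M | Har of idx M | Bdr of idx M.

Definition carrier (s : lsort) : Type :=
  match s with
  | Pt => hspace M | Dom U => dom U | Har U => har U | Bdr U => bdr U
  end.

Definition sort_gm (s : lsort) : gauged_metric R (carrier s) :=
  match s with
  | Pt => pt_gm M
  | Dom U => dom_gm U | Har U => har_gm U | Bdr U => bdr_gm U
  end.

Inductive var : seq lsort -> lsort -> Type :=
| VZ s G : var (s :: G) s
| VS t s G : var G s -> var (t :: G) s.

Inductive term (G : seq lsort) : lsort -> Type :=
| TVar s : var G s -> term G s
| TInX U : term G (Dom U) -> term G Pt
| TIncl V U : (sval V `<=` sval U) -> term G (Dom V) -> term G (Dom U)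
| TRestr V U : (sval V `<=` sval U) -> term G (Har U) -> term G (Har V)
| TDirichlet U : term G (Bdr U) -> term G (Har U)
| THar0 U : term G (Har U)
| THarLin U : R -> term G (Har U) -> term G (Har U) -> term G (Har U)
| TBdr0 U : term G (Bdr U)
| TBdrLin U : R -> term G (Bdr U) -> term G (Bdr U) -> term G (Bdr U).

Inductive quantifier := QInf | QSup.

(* Formulas of the definitional expansion of the language by the interpolation
   gauges ([FInterp]), with n real slots. [FQuant] ranges over the locus of
   gauge at most rho. Formulas of the original language are those without
   [FInterp]. *)
Inductive formula (n : nat) : seq lsort -> Type :=
| FSlot G : 'I_n -> formula n G
| FDist G s : term G s -> term G s -> formula n G
| FGauge G s : term G s -> formula n G
| FEval G U : term G (Dom U) -> term G (Har U) -> formula n G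
| FInterp G U k :
    ('I_k -> term G (Dom U)) -> ('I_k -> formula n G) -> formula n G
| FConn G k (c : 'rV[R]_k -> R) :
    continuous c -> ('I_k -> formula n G) -> formula n G
| FQuant G (b : quantifier) (s : lsort) (rho : R) :
    formula n (s :: G) -> formula n G.

Definition FConst n G (a : R) : formula n G :=
  @FConn n G 0 (fun=> a) (@cst_continuous _ _ a)
    (fun i => FSlot G (widen_ord (leq0n n) i)).

Fixpoint env (G : seq lsort) : Type :=
  if G is s :: G' then (carrier s * env G')%type else unit.

Fixpoint lookup G s (v : var G s) : env G -> carrier s :=
  match v in var G0 s0 return env G0 -> carrier s0 with
  | VZ _ _ => fun e => e.1
  | VS _ _ _ w => fun e => lookup w e.2
  end.

Fixpoint term_sem G s (t : term G s) (e : env G) : carrier s :=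
  match t in term _ s0 return carrier s0 with
  | TVar _ v => lookup v e
  | TInX _ a => inX (term_sem a e)
  | TIncl _ _ p a => dincl p (term_sem a e)
  | TRestr _ _ p a => hrestr p (term_sem a e)
  | TDirichlet _ a => dirichlet (term_sem a e)
  | THar0 _ => 0
  | THarLin _ c a b => c *: term_sem a e + term_sem b e
  | TBdr0 _ => 0
  | TBdrLin _ c a b => c *: term_sem a e + term_sem b e
  end.

Definition quant_sem (b : quantifier) : set R -> R :=
  match b with QInf => inf | QSup => sup end.

Fixpoint sem n G (phi : formula n G) : env G -> 'rV[R]_n -> R :=
  match phi in formula _ G0 return env G0 -> 'rV[R]_n -> R with
  | FSlot _ i => fun _ r => r ord0 i
  | FDist _ s t u =>
      fun e _ => gdist (sort_gm s) (term_sem t e) (term_sem u e)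
  | FGauge _ s t => fun e _ => gauge (sort_gm s) (term_sem t e)
  | FEval _ _ x h => fun e _ => Eval (term_sem x e) (term_sem h e)
  | FInterp _ _ _ x a => fun e r =>
      interp_gauge (fun i => term_sem (x i) e) (\row_i sem (a i) e r)
  | FConn _ _ c _ a => fun e r => c (\row_i sem (a i) e r)
  | FQuant _ b s rho psi => fun e r =>
      quant_sem b [set sem psi (a, e) r |
                     a in [set a : carrier s | gauge (sort_gm s) a <= rho]]
  end.

Definition renaming (G G' : seq lsort) := forall s, var G s -> var G' s.

Definition lift_renaming G G' (f : renaming G G') (t : lsort) :
    renaming (t :: G) (t :: G') :=
  fun s v =>
    match v in var G0 s0
      return (forall s', var (behead G0) s' -> var G' s') ->
             var (head t G0 :: G') s0 with
    | VZ s0 G0 => fun _ => VZ s0 G'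
    | VS t0 s0 _ w => fun g => VS t0 (g s0 w)
    end f.

Fixpoint rename_term G G' (f : renaming G G') s (t : term G s) : term G' s :=
  match t in term _ s0 return term G' s0 with
  | TVar _ v => TVar (f _ v)
  | TInX _ a => TInX (rename_term f a)
  | TIncl _ _ p a => TIncl p (rename_term f a)
  | TRestr _ _ p a => TRestr p (rename_term f a)
  | TDirichlet _ a => TDirichlet (rename_term f a)
  | THar0 U => THar0 G' U
  | THarLin _ c a b => THarLin c (rename_term f a) (rename_term f b)
  | TBdr0 U => TBdr0 G' U
  | TBdrLin _ c a b => TBdrLin c (rename_term f a) (rename_term f b)
  end.

Fixpoint rename n G (phi : formula n G) :
    forall G', renaming G G' -> formula n G' :=
  match phi in formula _ G0
    return forall G', renaming G0 G' -> formula n G' with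
  | FSlot _ i => fun G' _ => FSlot G' i
  | FDist _ _ t u => fun _ f => FDist n (rename_term f t) (rename_term f u)
  | FGauge _ _ t => fun _ f => FGauge n (rename_term f t)
  | FEval _ _ x h => fun _ f => FEval n (rename_term f x) (rename_term f h)
  | FInterp _ _ _ x a => fun _ f =>
      FInterp (fun i => rename_term f (x i)) (fun i => rename (a i) f)
  | FConn _ _ _ cc a => fun _ f => FConn cc (fun i => rename (a i) f)
  | FQuant _ b s rho psi => fun _ f =>
      FQuant b rho (rename psi (lift_renaming f (t:=s)))
  end.

Definition weakening (t : lsort) (G : seq lsort) : renaming G (t :: G) :=
  fun s v => VS t v.

Fixpoint fill n k G (phi : formula n G) :
    ('I_n -> formula k G) -> formula k G :=
  match phi in formula _ G0
    return ('I_n -> formula k G0) -> formula k G0 with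
  | FSlot _ i => fun a => a i
  | FDist _ _ t u => fun _ => FDist k t u
  | FGauge _ _ t => fun _ => FGauge k t
  | FEval _ _ x h => fun _ => FEval k x h
  | FInterp _ _ _ x b => fun a => FInterp x (fun i => fill (b i) a)
  | FConn _ _ _ cc b => fun a => FConn cc (fun i => fill (b i) a)
  | FQuant _ b s rho psi => fun a =>
      FQuant b rho (fill psi (fun i => rename (a i) (@weakening s _)))
  end.

(* Phi(z, ev_x(h)), with the harmonic variable h prepended to the context of z
   and x. *)
Definition at_evaluations G U m (x : 'I_m -> term G (Dom U))
    (Phi : formula m G) : formula 0 (Har U :: G) :=
  fill (rename Phi (@weakening (Har U) G))
    (fun i => FEval 0 (rename_term (@weakening (Har U) G) (x i))
                      (TVar (VZ (Har U) G))).

Fixpoint var_index G s (v : var G s) : nat :=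
  match v with VZ _ _ => 0 | VS _ _ _ w => (var_index w).+1 end.

Fixpoint term_vars G s (t : term G s) : seq nat :=
  match t with
  | TVar _ v => [:: var_index v]
  | TInX _ a => term_vars a
  | TIncl _ _ _ a => term_vars a
  | TRestr _ _ _ a => term_vars a
  | TDirichlet _ a => term_vars a
  | THar0 _ => [::]
  | THarLin _ _ a b => term_vars a ++ term_vars b
  | TBdr0 _ => [::]
  | TBdrLin _ _ a b => term_vars a ++ term_vars b
  end.

Definition is_var G s (k : nat) (t : term G s) : bool :=
  if t is TVar _ v then var_index v == k else false.

(* The variable of index k occurs only as the second argument of predicates
   Eval_U(x_i, -). Variables of index below k are bound inside its scope; the
   points x_i may not depend on them, since otherwise the variable would be
   evaluated at infinitely many points. *)
Fixpoint only_evaluated n G (k : nat) (phi : formula n G) : Prop :=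
  match phi with
  | FSlot _ _ => True
  | FDist _ _ t u => k \notin term_vars t ++ term_vars u
  | FGauge _ _ t => k \notin term_vars t
  | FEval _ _ x h =>
      (is_var k h && all (fun j => k < j)%N (term_vars x)) ||
      (k \notin term_vars h)
  | FInterp _ _ _ _ a => forall i, only_evaluated k (a i)
  | FConn _ _ _ _ a => forall i, only_evaluated k (a i)
  | FQuant _ _ _ _ psi => only_evaluated k.+1 psi
  end.

Fixpoint finite_evaluation n G (phi : formula n G) : Prop :=
  match phi with
  | FInterp _ _ _ _ a => forall i, finite_evaluation (a i)
  | FConn _ _ _ _ a => forall i, finite_evaluation (a i)
  | FQuant _ _ s _ psi =>
      finite_evaluation psi /\ (if s is Har _ then only_evaluated 0 psi else True)
  | _ => True
  end.

Definition bounded_locus G (Z : set (env G)) :=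
  exists b : R, forall e, Z e ->
    forall s (v : var G s), gauge (sort_gm s) (lookup v e) <= b.

Definition unif_cont_in_slots m G (Phi : formula m G) (Z : set (env G)) :=
  forall b e : R, 0 < e -> exists2 d : R, 0 < d &
    forall z, Z z -> forall r s : 'rV[R]_m,
      (forall i, `|r ord0 i| <= b) -> (forall i, `|s ord0 i| <= b) ->
      (forall i, `|r ord0 i - s ord0 i| < d) ->
      `|sem Phi z r - sem Phi z s| < e.

(* Finite continuous combinations of instances q_{U,x}(r), of the point data
   of x, and of the original evaluation data Phi(z, r), at constants r. *)
Inductive combination G U m (x : 'I_m -> term G (Dom U)) (Phi : formula m G) :
    formula 0 G -> Prop :=
| comb_interp (r : 'rV[R]_m) :
    combination x Phi (FInterp x (fun i => FConst 0 G (r ord0 i)))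
| comb_point_dist i j : combination x Phi (FDist 0 (x i) (x j))
| comb_point_gauge i : combination x Phi (FGauge 0 (x i))
| comb_eval (r : 'rV[R]_m) :
    combination x Phi (fill Phi (fun i => FConst 0 G (r ord0 i)))
| comb_conn k (c : 'rV[R]_k -> R) (cc : continuous c) a :
    (forall i, combination x Phi (a i)) -> combination x Phi (FConn cc a).

Definition uniform_limit_on G (D : set (env G)) (C : formula 0 G -> Prop)
    (phi : formula 0 G) :=
  exists2 psi : nat -> formula 0 G, forall n, C (psi n) &
    forall eps : R, 0 < eps -> exists N, forall n, (N <= n)%N ->
      forall e, D e -> `|sem (psi n) e 0 - sem phi e 0| < eps.

End BrelotHarmonicSpaces.

(* Main.v *)
Require Import Defs.
From HB Require Import structures.
From mathcomp Require Import all_boot all_order all_algebra.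
From mathcomp Require Import all_classical all_reals all_analysis.
From mathcomp Require Import ring lra.
Import Order.TTheory GRing.Theory Num.Theory.
Import numFieldNormedType.Exports.

Set Implicit Arguments.
Unset Strict Implicit.
Unset Printing Implicit Defensive.

Local Open Scope classical_set_scope.
Local Open Scope ring_scope.

(** Write q for the interpolation gauge at a tuple x, and E for the set of
    values at x of the harmonic functions of gauge at most rho.  Since q is an
    infimum of gauges over an affine set of functions, it is subadditive and
    absolutely homogeneous, and the inclusions {q < rho} <= E <= {q <= rho} are
    immediate.  Everything else rests on comparing q with the sup norm of
    tuples, uniformly over the separated tuples of K:

    - the bound on evaluations gives |r_i| <= B q(r)
      ([le_interp_gauge]), so the sets {q <= rho} lie in a common box, and
      shrinking r slightly towards 0 moves it little while lowering q strictly
      below rho ([shrink_into_ball]);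

    - conversely q(r) <= C max |r_i| ([interp_gauge_uniform_bound]).  Near a
      fixed injective tuple x0, functions interpolating the standard basis at
      x0 still interpolate it approximately at x, and this already bounds q at x
      ([interp_gauge_le_approx_basis]).  Near a tuple with a repeated point no
      tuple is separated.  Compactness of the power of K makes C uniform.

    The first comparison and the shrinking give the density of {q < rho} in
    {q <= rho}, the second the closedness of {q <= rho}.

    A quantifier over the ball of radius rho is an infimum or supremum of
    f = Phi(z, -) over E.  By uniform continuity of f one would like to replace
    E by the points of a fine grid of the box lying in E, but membership in E is
    not a continuous condition.  It is replaced by a penalty
    lambda * max(0, q(r) - rho): a grid point with q(r) slightly above rho is
    close to E, a grid point with q(r) much above rho is made harmless by a
    large lambda, and by the bound on q every point of E has a grid point near
    it whose penalty is small ([inf_penalized_min]).  The resulting finite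
    minimum is a combination of instances of q and Phi at constants, with
    a grid and a lambda that do not depend on z and x.  Note that Phi(z, -) need
    not be bounded uniformly in z; only its oscillation on the box is
    ([oscillation_le]), which is what lambda has to beat. *)

(** * Semantics of renaming and substitution *)

Lemma rename_term_sem (R : realType) (M : har_structure R)
    (G G' : seq (lsort M)) (f : renaming G G') (e : env G) (e' : env G') :
  (forall s (v : var G s), lookup (f s v) e' = lookup v e) ->
  forall s (t : term G s), term_sem (rename_term f t) e' = term_sem t e.
Proof.
by move=> fe s; elim=> //= [U t ->|V U p t ->|V U p t ->|U t ->|U c t -> u ->
  |U c t -> u ->].
Qed.

(** The index of a variable of t :: G is a constructor application, so a direct
    case analysis is ill-typed; the match generalizes over all contexts, with a
    trivial claim on the empty one. *)
Lemma var_consP (R : realType) (M : har_structure R) (t : lsort M)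
    (G : seq (lsort M)) (P : forall s, var (t :: G) s -> Prop) :
  P t (VZ t G) -> (forall s (w : var G s), P s (VS t w)) ->
  forall s (v : var (t :: G) s), P s v.
Proof.
move=> PZ PS s v.
refine (match v in var G0 s0 return
  (match G0 return var G0 s0 -> Prop with
   | [::] => fun=> True
   | t1 :: G1 => fun v1 => forall Q : forall s, var (t1 :: G1) s -> Prop,
       Q t1 (VZ t1 G1) -> (forall s w, Q s (VS t1 w)) -> Q s0 v1
   end) v with VZ _ _ => _ | VS _ _ _ w => _ end P PZ PS).
- by move=> Q QZ.
- by move=> Q _; apply.
Qed.

Lemma sem_rename (R : realType) (M : har_structure R) (n : nat)
    (G : seq (lsort M)) (phi : formula n G) (G' : seq (lsort M))
    (f : renaming G G') (e : env G) (e' : env G') (r : 'rV[R]_n) :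
  (forall s (v : var G s), lookup (f s v) e' = lookup v e) ->
  sem (rename phi f) e' r = sem phi e r.
Proof.
elim: phi G' f e e' r => {G} [G i|G s t u|G s t|G U x h|G U k x a IH
  |G k c cc a IH|G b s rho psi IH] G' f e e' r fe //=.
- by rewrite !(rename_term_sem fe).
- by rewrite !(rename_term_sem fe).
- by rewrite !(rename_term_sem fe).
- congr (interp_gauge _ _).
    by apply/funext => i; rewrite (rename_term_sem fe).
  by apply/rowP => i; rewrite !mxE (IH i _ _ e).
- by congr c; apply/rowP => i; rewrite !mxE (IH i _ _ e).
- congr (quant_sem b (_ @` _)); apply/funext => a.
  by apply: IH; apply: var_consP => // s' w; exact: fe.
Qed.

Lemma sem_fill (R : realType) (M : har_structure R) (n k : nat)
    (G : seq (lsort M)) (phi : formula n G) (a : 'I_n -> formula k G)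
    (e : env G) (r : 'rV[R]_k) :
  sem (fill phi a) e r = sem phi e (\row_i sem (a i) e r).
Proof.
elim: phi k a e r => {G} [G i|G s t u|G s t|G U x h|G U l x b IH
  |G l c cc b IH|G b s rho psi IH] k a e r //=.
- by rewrite mxE.
- by congr interp_gauge; apply/rowP => i; rewrite !mxE IH.
- by congr c; apply/rowP => i; rewrite !mxE IH.
- congr (quant_sem b (_ @` _)); apply/funext => z.
  rewrite IH; congr sem; apply/rowP => i.
  by rewrite !mxE (@sem_rename _ _ _ _ _ _ _ e).
Qed.

(** Reduces a quantifier over harmonic functions to an optimization problem over
    a bounded set of tuples, which is the form in which it is eliminated. *)
Lemma sem_quant_at_evaluations (R : realType) (M : har_structure R)
    (G : seq (lsort M)) (U : idx M) (m : nat) (x : 'I_m -> term G (Dom U))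
    (Phi : formula m G) (b : quantifier) (rho : R) (e : env G) :
  sem (FQuant b rho (at_evaluations x Phi)) e 0 =
  quant_sem b (sem Phi e @` eval_set rho (fun i => term_sem (x i) e)).
Proof.
rewrite /= /eval_set image_comp; congr (quant_sem b (_ @` _)).
apply/funext => h /=.
rewrite /at_evaluations sem_fill (@sem_rename _ _ _ _ _ _ _ e) //.
congr sem; apply/rowP => i; rewrite !mxE /=.
by rewrite (@rename_term_sem _ _ _ _ _ e).
Qed.

(** * Penalized minima over a grid *)

(** The range of the indices is the largest one that keeps the grid inside the box
    [-b, b]^m. *)
Definition box_grid (R : realType) (m : nat) (b eta : R)
    (k : {ffun 'I_m -> 'I_(Num.truncn (2 * b / eta)).+1}) : 'rV[R]_m :=
  \row_i (- b + eta * (k i)%:R).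

Lemma box_grid_in_box (R : realType) (m : nat) (b eta : R) k (i : 'I_m) :
  0 <= b -> 0 < eta -> `|@box_grid R m b eta k ord0 i| <= b.
Proof.
move=> b0 eta0; rewrite mxE ler_norml.
have : (k i)%:R <= 2 * b / eta.
  have be0 : 0 <= 2 * b / eta by rewrite divr_ge0 ?mulr_ge0 // ltW.
  have /andP[+ _] := truncn_itv be0.
  by apply: le_trans; rewrite ler_nat -ltnS.
rewrite ler_pdivlMr// mulrC => kb; apply/andP; split; last lra.
by rewrite lerDl mulr_ge0// ltW.
Qed.

Lemma box_grid_near (R : realType) (m : nat) (b eta : R) (r : 'rV[R]_m) :
  0 < eta -> (forall i, `|r ord0 i| <= b) ->
  exists k, forall i, `|r ord0 i - @box_grid R m b eta k ord0 i| <= eta.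
Proof.
move=> eta0 rb.
exists [ffun i => inord (Num.truncn ((r ord0 i + b) / eta))] => i.
have := rb i; rewrite ler_norml => /andP[r1 r2].
have rb0 : 0 <= (r ord0 i + b) / eta by apply: divr_ge0; lra.
rewrite mxE ffunE inordK; last first.
  rewrite ltnS; apply: le_truncn; rewrite ler_pM2r ?invr_gt0//; lra.
have /andP[] := truncn_itv rb0; set n := Num.truncn _.
rewrite ler_pdivlMr// ltr_pdivrMr// -natr1 => n1 n2.
rewrite ler_norml; apply/andP; split; lra.
Qed.

(** Walking from 0 to r along the segment in N steps of size less than d, each of
    which changes f by less than 1. *)
Lemma oscillation_le (R : realType) (m : nat) (f : 'rV[R]_m -> R) (b d : R)
    (N : nat) : 0 <= b ->
  (forall r s : 'rV[R]_m, (forall i, `|r ord0 i| <= b) ->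
     (forall i, `|s ord0 i| <= b) -> (forall i, `|r ord0 i - s ord0 i| < d) ->
     `|f r - f s| < 1) ->
  b < d * N%:R -> forall r : 'rV[R]_m, (forall i, `|r ord0 i| <= b) ->
  `|f 0 - f r| <= N%:R.
Proof.
move=> b0 fd bN r rb.
have [N0|N0] := posnP N; first by move: bN; rewrite N0 mulr0 ltNge b0.
have N0R : 0 < N%:R :> R by rewrite ltr0n.
suff H n : (n <= N)%N -> `|f 0 - f ((n%:R / N%:R) *: r)| <= n%:R.
  by have := H _ (leqnn N); rewrite divff ?scale1r// gt_eqF.
elim: n => [_|n IH nN]; first by rewrite mul0r scale0r subrr normr0.
have scaled k i : (k <= N)%N -> `|((k%:R / N%:R) *: r) ord0 i| <= b.
  move=> kN; rewrite mxE normrM ger0_norm ?divr_ge0//.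
  rewrite -[leRHS]mul1r ler_pM ?divr_ge0//.
  by rewrite ler_pdivrMr// mul1r ler_nat.
rewrite -(subrKA (f ((n%:R / N%:R) *: r))); apply: le_trans (ler_normD _ _) _.
rewrite -[leRHS]natr1; apply: lerD; first exact: IH (ltnW nN).
apply/ltW/fd => [i|i|i]; rewrite ?scaled// 1?ltnW//.
rewrite !mxE -mulrBl -mulrBl -natr1 opprD addrA subrr sub0r mulN1r mulNr normrN.
rewrite normrM ger0_norm ?invr_ge0// mulrC ltr_pdivrMr//.
exact: le_lt_trans (rb i) bN.
Qed.

(** Scaling by theta = b / (b + d) moves the points of the box by less than d,
    and still lowers q below rho when q exceeds rho a little.  That kappa and t
    do not depend on q is what makes the later estimates uniform. *)
Lemma shrink_into_ball (R : realType) (rho b d : R) :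
  0 < rho -> 0 < b -> 0 < d -> exists kappa t : R,
  [/\ 0 < kappa, t < rho & forall (m : nat) (q : 'rV[R]_m -> R),
    (forall a r, q (a *: r) <= `|a| * q r) ->
    forall r : 'rV[R]_m, (forall i, `|r ord0 i| <= b) ->
    q r <= rho + kappa -> exists s : 'rV[R]_m,
      [/\ q s <= t, forall i, `|r ord0 i - s ord0 i| < d &
          forall i, `|s ord0 i| <= b]].
Proof.
move=> rho0 b0 d0; have bd0 : 0 < b + d by lra.
pose theta := b / (b + d).
have theta0 : 0 <= theta by rewrite divr_ge0// ltW.
have theta1 : theta <= 1 by rewrite ler_pdivrMr//; lra.
(* Any kappa below rho * d / b keeps theta * (rho + kappa) below rho. *)
exists (rho * d / (2 * b)), (theta * (rho + rho * d / (2 * b))); split.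
- by rewrite divr_gt0// mulr_gt0.
- have -> : theta * (rho + rho * d / (2 * b)) = rho * ((b + d / 2) / (b + d)).
    by rewrite /theta; field; rewrite !gt_eqF.
  by rewrite -[ltRHS]mulr1 ltr_pM2l// ltr_pdivrMr//; lra.
- move=> m q qZ r rb qr; exists (theta *: r); split => [|i|i].
  + by apply: (le_trans (qZ _ _)); rewrite ger0_norm// ler_wpM2l.
  + rewrite mxE -[X in X - _]mul1r -mulrBl normrM.
    have -> : 1 - theta = d / (b + d) by rewrite /theta; field; rewrite gt_eqF.
    rewrite ger0_norm ?divr_ge0 1?ltW//.
    apply: (@le_lt_trans _ _ (d / (b + d) * b)).
      by rewrite ler_wpM2l// divr_ge0// ltW.
    by rewrite mulrAC ltr_pdivrMr// mulrDr mulrC ltrDl mulr_gt0.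
  + rewrite mxE normrM ger0_norm// -[leRHS]mul1r ler_pM//.
Qed.

(** The term f 0 costs no penalty as q 0 <= rho, so it can serve as the initial
    value of the iterated minimum. *)
Definition penalized_min (R : realType) (m : nat) (I : finType)
    (net : I -> 'rV[R]_m) (lambda rho : R) (q f : 'rV[R]_m -> R) : R :=
  \big[Num.min/f 0]_(k : I)
    (f (net k) + lambda * Num.max 0 (q (net k) - rho)).

(** The slope lambda and the mesh eta are chosen before q, f and E: a single
    connective and a single grid have to serve for all values of the parameters. *)
Lemma inf_penalized_min (R : realType) (m : nat) (rho b C L d eps : R) :
  0 < rho -> 0 < b -> 0 < C -> 0 < L -> 0 < d -> 0 < eps ->
  exists (lambda eta : R), forall (q f : 'rV[R]_m -> R) (E : set 'rV[R]_m),
  (forall a r, q (a *: r) <= `|a| * q r) ->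
  (forall r s, q (r + s) <= q r + q s) ->
  (forall (r : 'rV[R]_m) e, 0 <= e -> (forall i, `|r ord0 i| <= e) ->
     q r <= C * e) ->
  E 0 -> [set r | q r < rho] `<=` E ->
  (forall r : 'rV[R]_m, E r -> q r <= rho /\ forall i, `|r ord0 i| <= b) ->
  (forall r s : 'rV[R]_m, (forall i, `|r ord0 i| <= b) ->
     (forall i, `|s ord0 i| <= b) -> (forall i, `|r ord0 i - s ord0 i| < d) ->
     `|f r - f s| < eps) ->
  (forall r : 'rV[R]_m, (forall i, `|r ord0 i| <= b) -> `|f 0 - f r| <= L) ->
  `|penalized_min (@box_grid R m b eta) lambda rho q f - inf (f @` E)|
    <= 2 * eps.
Proof.
move=> rho0 b0 C0 L0 d0 eps0.
have [kappa [t [kappa0 trho shrink]]] := shrink_into_ball rho0 b0 d0.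
(* A point with q > rho + kappa is penalized by at least lambda * kappa = L,
   hence exceeds f 0; the mesh is such that a grid point within eta of E is
   penalized by at most lambda * C * eta <= eps. *)
pose lambda := L / kappa; have lambda0 : 0 < lambda by rewrite divr_gt0.
have lC0 : 0 < lambda * C by rewrite mulr_gt0.
pose eta := Num.min (d / 2) (eps / (lambda * C)).
have eta0 : 0 < eta by rewrite lt_min !divr_gt0.
exists lambda, eta => q f E qZ qD qC E0 qE Eq fd fL.
have inE r : E r -> inf (f @` E) <= f r.
  move=> Er; apply: ge_inf; last by exists r.
  by exists (f 0 - L) => _ [s /Eq[_ /fL fs] <-]; move: fs; rewrite ler_norml; lra.
rewrite ler_distlC; apply/andP; split.
  (* The minimum is at most inf f + 2 eps: round a point of E to the grid. *)
  apply: lb_le_inf; first by exists (f 0), 0.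
  move=> _ [s Es <-]; have [qs sb] := Eq s Es; rewrite lerBlDr.
  have [k sk] := box_grid_near eta0 sb; rewrite /penalized_min.
  apply: le_trans (bigmin_le _ k _) _; set r := box_grid k.
  have eta_d : eta < d by rewrite gt_min; apply/orP; left; lra.
  have etaC : lambda * (C * eta) <= eps.
    by rewrite mulrA mulrC -ler_pdivlMr// ge_min lexx orbT.
  have frs : f r < f s + eps.
    have := fd s r sb; rewrite ltr_norml => H.
    have /andP[] : (- eps < f s - f r < eps).
      apply: H => i; first by apply: box_grid_in_box => //; exact: ltW.
      exact: le_lt_trans (sk i) eta_d.
    lra.
  have qr : Num.max 0 (q r - rho) <= C * eta.
    have Ceta0 : 0 <= C * eta by rewrite ltW// mulr_gt0.
    rewrite ge_max Ceta0/= lerBlDl -(subrKC s r).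
    apply: (le_trans (qD _ _)); apply: lerD => //; apply: qC; first exact: ltW.
    by move=> i; have := sk i; rewrite distrC !mxE.
  have := ler_wpM2l (ltW lambda0) qr; lra.
(* Each term is at least inf f - eps: for q r <= rho + kappa by shrinking r into
   E, otherwise because of the penalty. *)
rewrite -lerBlDr; apply: le_bigmin => [|k _]; first by have := inE _ E0; lra.
set r := box_grid k.
have rb i : `|r ord0 i| <= b by apply: box_grid_in_box => //; exact: ltW.
have [qr|qr] := leP (q r) (rho + kappa).
  have [s [qs rs sb]] := shrink _ _ qZ _ rb qr.
  have Es : E s by apply: qE => /=; exact: le_lt_trans trho.
  have := fd _ _ rb sb rs; rewrite ltr_norml => /andP[frs _].
  have := inE _ Es.
  have : 0 <= lambda * Num.max 0 (q r - rho).
    by apply: mulr_ge0; [exact: ltW|rewrite le_max lexx].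
  lra.
have : L <= lambda * Num.max 0 (q r - rho).
  have -> : L = lambda * kappa by rewrite /lambda divfK// gt_eqF.
  by rewrite ler_pM2l// le_max; apply/orP; right; lra.
have := fL r rb; rewrite ler_norml => /andP[_ fr].
have := inE _ E0; lra.
Qed.

(** * The interpolation gauge as a seminorm *)

Lemma gauge0 (R : realType) (M : har_structure R) (U : idx M) :
  harmonic_gauge_axioms M -> gauge (har_gm U) 0 = 0.
Proof.
by move=> /(_ U)[gZ _]; rewrite -[X in gauge _ X](scale0r 0) gZ normr0 mul0r.
Qed.

Lemma ev_lin (R : realType) (M : har_structure R) (U : idx M) (m : nat)
    (x : 'I_m -> dom U) (a : R) (h k : har U) :
  compatibility_axioms M -> ev x (a *: h + k) = a *: ev x h + ev x k.
Proof. by case=> _ _ _ _ E; apply/rowP => i; rewrite !mxE E. Qed.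

Lemma ev0 (R : realType) (M : har_structure R) (U : idx M) (m : nat)
    (x : 'I_m -> dom U) :
  compatibility_axioms M -> ev x 0 = 0.
Proof.
move=> /(@ev_lin _ _ _ _ x 1 0 0); rewrite !scale1r addr0 => /esym/eqP.
by rewrite addrC -subr_eq0 addrK => /eqP.
Qed.

Lemma evZ (R : realType) (M : har_structure R) (U : idx M) (m : nat)
    (x : 'I_m -> dom U) (a : R) (h : har U) :
  compatibility_axioms M -> ev x (a *: h) = a *: ev x h.
Proof. by move=> C; rewrite -[a *: h]addr0 ev_lin// ev0// addr0. Qed.

Lemma interp_gauge_le (R : realType) (M : har_structure R) (U : idx M)
    (m : nat) (x : 'I_m -> dom U) (h : har U) :
  interp_gauge x (ev x h) <= gauge (har_gm U) h.
Proof.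
apply: ge_inf; last by exists h.
by exists 0 => _ [k _ <-]; exact: gauge_ge0.
Qed.

Section InterpolationGauge.
Context (R : realType) (M : har_structure R) (U : idx M) (m : nat).
Context (x : 'I_m -> dom U).
Hypothesis ev_surj : forall r : 'rV[R]_m, exists h, ev x h = r.

Lemma interp_gauge_lt (r : 'rV[R]_m) (t : R) :
  interp_gauge x r < t -> exists2 h, ev x h = r & gauge (har_gm U) h < t.
Proof.
move=> /inf_lt[|_ [h hr <-] ht]; last by exists h.
by have [h hr] := ev_surj r; exists (gauge (har_gm U) h), h.
Qed.

Lemma interp_gauge_ge (r : 'rV[R]_m) (t : R) :
  (forall h, ev x h = r -> t <= gauge (har_gm U) h) -> t <= interp_gauge x r.
Proof.
move=> H; apply: lb_le_inf => [|_ [h hr <-]]; last exact: H.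
by have [h hr] := ev_surj r; exists (gauge (har_gm U) h), h.
Qed.

Hypotheses (gaugeA : harmonic_gauge_axioms M) (compA : compatibility_axioms M).

Lemma interp_gaugeD (r s : 'rV[R]_m) :
  interp_gauge x (r + s) <= interp_gauge x r + interp_gauge x s.
Proof.
rewrite -lerBlDr; apply: interp_gauge_ge => h hr.
rewrite lerBlDr -lerBlDl; apply: interp_gauge_ge => k ks.
rewrite lerBlDl; apply: le_trans ((gaugeA U).2 h k).
by rewrite -hr -ks -[ev x h]scale1r -ev_lin// scale1r; exact: interp_gauge_le.
Qed.

Lemma interp_gauge0 : interp_gauge x 0 <= 0.
Proof. by rewrite -(gauge0 U)// -(ev0 x)//; exact: interp_gauge_le. Qed.

Lemma interp_gaugeZ (a : R) (r : 'rV[R]_m) :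
  interp_gauge x (a *: r) <= `|a| * interp_gauge x r.
Proof.
have [->|a0] := eqVneq a 0.
  by rewrite scale0r normr0 mul0r; exact: interp_gauge0.
rewrite mulrC -ler_pdivrMr ?normr_gt0//; apply: interp_gauge_ge => h hr.
rewrite ler_pdivrMr ?normr_gt0// mulrC -(gaugeA U).1 -hr.
by rewrite -evZ//; exact: interp_gauge_le.
Qed.

Lemma interp_gauge_sum (I : finType) (F : I -> 'rV[R]_m) :
  interp_gauge x (\sum_i F i) <= \sum_i interp_gauge x (F i).
Proof.
apply: (big_ind2 (fun r t => interp_gauge x r <= t)) => //.
  exact: interp_gauge0.
move=> r a s b ra sb; apply: (le_trans (interp_gaugeD _ _)).
  exact: lerD.
Qed.

Lemma interp_gauge_le_basis (r : 'rV[R]_m) :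
  interp_gauge x r <= \sum_i `|r ord0 i| * interp_gauge x (delta_mx ord0 i).
Proof.
rewrite [in X in X <= _](row_sum_delta r); apply: le_trans (interp_gauge_sum _) _.
by apply: ler_sum => i _; exact: interp_gaugeZ.
Qed.

Lemma interp_gauge_ge0 (r : 'rV[R]_m) : 0 <= interp_gauge x r.
Proof. by apply: interp_gauge_ge => h _; exact: gauge_ge0. Qed.

Lemma le_interp_gauge (B : R) (r : 'rV[R]_m) (i : 'I_m) : 0 < B ->
  (forall h, `|Eval (x i) h| <= B * gauge (har_gm U) h) ->
  `|r ord0 i| <= B * interp_gauge x r.
Proof.
move=> B0 hB; rewrite mulrC -ler_pdivrMr//; apply: interp_gauge_ge => h <-.
by rewrite ler_pdivrMr// mulrC mxE.
Qed.

(** If the h i interpolate the standard basis up to an error 1/(2m), then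
    splitting each basis vector into the values of h i and the error bounds the
    sum S of the gauges of the basis by sum_i gauge (h i) + S / 2.  As S is finite
    this gives S <= 2 * sum_i gauge (h i), without inverting the matrix of
    values of the h i. *)
Lemma interp_gauge_le_approx_basis (h : 'I_m -> har U) :
  (forall i j, `|Eval (x j) (h i) - (i == j)%:R| <= (2 * m%:R)^-1) ->
  forall (r : 'rV[R]_m) (e : R), 0 <= e ->
  (forall i, `|r ord0 i| <= e) ->
  interp_gauge x r <= (2 * \sum_i gauge (har_gm U) (h i)) * e.
Proof.
move=> happrox.
set S := \sum_i interp_gauge x (delta_mx ord0 i).
set g := \sum_i gauge _ _.
have basis_le i : interp_gauge x (delta_mx ord0 i) <=
    gauge (har_gm U) (h i) + (2 * m%:R)^-1 * S.
  rewrite -(subrK (ev x (h i)) (delta_mx ord0 i)) addrC.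
  apply: le_trans (interp_gaugeD _ _) _.
  apply: lerD; first exact: interp_gauge_le.
  apply: le_trans (interp_gauge_le_basis _) _.
  rewrite /S mulr_sumr; apply: ler_sum => j _.
  rewrite ler_wpM2r ?interp_gauge_ge0//.
  by rewrite !mxE/= distrC eq_sym happrox.
have S_le : S <= 2 * g.
  have : S <= g + m%:R * ((2 * m%:R)^-1 * S).
    rewrite mulr_natl -[X in _ *+ X]card_ord -sumr_const -big_split.
    by apply: ler_sum => i _.
  have S0 : 0 <= S by apply: sumr_ge0 => i _; exact: interp_gauge_ge0.
  have [m0|m0] := eqVneq (m%:R : R) 0.
    have : 0 <= g by apply: sumr_ge0 => i _; exact: gauge_ge0.
    rewrite m0 mul0r => ? ?.
    lra.
  by rewrite invfM mulrA mulrCA divff// mulr1; lra.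
move=> r e e0 re; apply: le_trans (interp_gauge_le_basis r) _.
apply: (@le_trans _ _ (S * e)); last by rewrite ler_wpM2r.
rewrite mulrC /S mulr_sumr; apply: ler_sum => i _.
by rewrite ler_wpM2r ?interp_gauge_ge0.
Qed.

End InterpolationGauge.

(** * Evaluation sets and balls of the interpolation gauge *)

Section EvalSet.
Context (R : realType) (M : har_structure R) (U : idx M) (m : nat).
Context (x : 'I_m -> dom U) (rho : R).
Hypothesis ev_surj : forall r : 'rV[R]_m, exists h, ev x h = r.

Lemma interp_gauge_lt_eval_set :
  [set r : 'rV[R]_m | interp_gauge x r < rho] `<=` eval_set rho x.
Proof. by move=> r /(interp_gauge_lt ev_surj)[h hr /ltW hrho]; exists h. Qed.

Lemma eval_set_interp_gauge_le :
  eval_set rho x `<=` [set r | interp_gauge x r <= rho].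
Proof. by move=> _ [h hrho <-]; exact: le_trans (interp_gauge_le x h) hrho. Qed.

(** The bound on q makes {q <= rho} closed, and the density hypothesis puts it in
    the closure of {q < rho}. *)
Lemma closure_eval_set (C : R) :
  (forall r s : 'rV[R]_m,
     interp_gauge x (r + s) <= interp_gauge x r + interp_gauge x s) ->
  (forall (r : 'rV[R]_m) (e : R), 0 <= e -> (forall i, `|r ord0 i| <= e) ->
     interp_gauge x r <= C * e) ->
  0 < C ->
  (forall (r : 'rV[R]_m) (eps : R), 0 < eps -> interp_gauge x r <= rho ->
     exists2 s : 'rV[R]_m, interp_gauge x s < rho &
       forall i, `|r ord0 i - s ord0 i| < eps) ->
  closure (eval_set rho x) = [set r | interp_gauge x r <= rho].
Proof.
move=> qD qC C0 dense; apply/seteqP; split=> r /= Hr.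
  apply/ler_addgt0Pl => e e0; have eC0 : 0 < e / C by rewrite divr_gt0.
  have [s [/eval_set_interp_gauge_le /= sq [_ rs]]] :=
    Hr _ (nbhsx_ballx r (e / C) eC0).
  rewrite -(subrK s r); apply: (le_trans (qD _ _)); apply: lerD => //.
  have -> : e = C * (e / C) by rewrite mulrC divfK// gt_eqF.
  apply: qC => [|i]; first exact: ltW.
  by rewrite !mxE; exact/ltW/(rs ord0 i).
move=> A /nbhs_ballP[e e0 eA]; have [s sq rs] := dense r e e0 Hr.
exists s; split; first exact: interp_gauge_lt_eval_set.
by apply: eA; split=> // i j; rewrite (ord1 i); exact: rs.
Qed.

End EvalSet.

(** * Uniform interpolation bounds on compact sets *)

Lemma gdist_xx (R : realType) (T : Type) (g : gauged_metric R T) (x : T) :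
  gdist g x x = 0.
Proof. exact/gdist_eq0. Qed.

Lemma separated_inj (R : realType) (M : har_structure R) (U : idx M)
    (K : set (hspace M)) (m : nat) (d : R) (x : 'I_m -> dom U) :
  0 < d -> separated_tuples K d x -> injective x.
Proof.
move=> d0 [_ sep] i j xij; apply/val_inj/eqP.
rewrite eqn_leq leqNgt [X in _ && X]leqNgt.
by apply/andP; split; apply/negP => /sep; rewrite xij gdist_xx leNgt d0.
Qed.

Section UniformInterpolation.
Context (R : realType) (M : har_structure R) (U : idx M).
Hypotheses (domA : domain_sort_axioms M) (gaugeA : harmonic_gauge_axioms M).
Hypotheses (compA : compatibility_axioms M).
Hypothesis Eval_cont : forall (h : har U) (x : dom U) (e : R), 0 < e ->
  exists2 A, nbhs (inX x) A &
    forall y : dom U, A (inX y) -> `|Eval x h - Eval y h| < e.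
Hypothesis FI : finite_interpolation M.

Import ArrowAsProduct.

(** The domain sorts carry a metric but no topology, so compactness is used in
    the power of the ambient space. *)
Lemma near_tuple (m : nat) (f : forall i : 'I_m, hspace M) (i : 'I_m)
    (A : set (hspace M)) :
  nbhs (f i) A ->
  \forall f' \near (f : prod_topology (fun _ : 'I_m => hspace M)), A (f' i).
Proof. exact: (@proj_continuous _ (fun _ : 'I_m => hspace M) i f). Qed.

(** Functions interpolating the standard basis at x0 interpolate it up to 1/(2m)
    at nearby tuples, by continuity of harmonic functions. *)
Lemma near_interp_gauge (m : nat) (x0 : 'I_m -> dom U) :
  (0 < m)%N -> injective x0 -> exists C : R,
  \forall f \near ((fun i => inX (x0 i)) :
                      prod_topology (fun _ : 'I_m => hspace M)),
    forall x : 'I_m -> dom U, (forall i, inX (x i) = f i) -> injective x ->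
    forall (r : 'rV[R]_m) (e : R), 0 <= e -> (forall i, `|r ord0 i| <= e) ->
      interp_gauge x r <= C * e.
Proof.
move=> m0 x0inj.
have /choice[h hE] : forall i : 'I_m, exists h, ev x0 h = delta_mx ord0 i.
  by move=> i; exact: FI.
have e0 : (0 : R) < (2 * m%:R)^-1 by rewrite invr_gt0 mulr_gt0// ltr0n.
have /choice[A AP] : forall p : 'I_m * 'I_m, exists A,
    nbhs (inX (x0 p.2)) A /\ forall y : dom U, A (inX y) ->
      `|Eval (x0 p.2) (h p.1) - Eval y (h p.1)| < (2 * m%:R)^-1.
  by move=> p; have [A ? ?] := Eval_cont (h p.1) (x0 p.2) e0; exists A.
exists (2 * \sum_i gauge (har_gm U) (h i)).
have : \forall f \near ((fun i => inX (x0 i)) :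
    prod_topology (fun _ : 'I_m => hspace M)), forall p, A p (f p.2).
  apply: (@filter_forall _ _
    (fun p (f : prod_topology (fun _ : 'I_m => hspace M)) => A p (f p.2))
    _ (nbhs_filter _)) => p.
  exact: (near_tuple (i := p.2) (AP p).1).
apply: filterS => f Af x xf xinj; apply: interp_gauge_le_approx_basis => //.
  by move=> r; exact: FI.
move=> i j; have -> : (i == j)%:R = Eval (x0 j) (h i).
  by have /rowP/(_ j) := hE i; rewrite !mxE/= eq_sym.
by rewrite distrC; apply/ltW/((AP (i, j)).2 (x j)); rewrite xf; exact: Af (i, j).
Qed.

(** If two points of x0 coincide, the corresponding points of a nearby tuple are
    both within d / 2 of their common value. *)
Lemma near_not_separated (m : nat) (x0 : 'I_m -> dom U) (K : set (hspace M))
    (d : R) : 0 < d -> ~ injective x0 ->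
  \forall f \near ((fun i => inX (x0 i)) :
                      prod_topology (fun _ : 'I_m => hspace M)),
    forall x : 'I_m -> dom U, (forall i, inX (x i) = f i) ->
      ~ separated_tuples K d x.
Proof.
move=> d0 x0inj.
have [i [j [ij xij]]] : exists i j : 'I_m, (i < j)%N /\ x0 i = x0 j.
  apply: contrapT => H; apply: x0inj => i j xij; apply/val_inj; move: xij => /= xij.
  by case: (ltngtP i j) => // ij; exfalso; apply: H; [exists i, j|exists j, i].
have [inj _ nbhsE] := domA U.
pose A : set (hspace M) :=
  [set inX y | y in [set y : dom U | gdist (dom_gm U) (x0 i) y < d / 2]].
have A0 : nbhs (inX (x0 i)) A.
  by apply/nbhsE; exists (d / 2); [rewrite divr_gt0|move=> y xy; exists y].
have Ad (y : dom U) : A (inX y) -> gdist (dom_gm U) (x0 i) y < d / 2.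
  by move=> [z + /inj <-].
have Ai := near_tuple (f := fun i => inX (x0 i)) (i := i) A0.
have Aj := near_tuple (f := fun i => inX (x0 i)) (i := j).
rewrite /= -xij in Aj.
apply: filterS (filterI Ai (Aj _ A0)) => f [{}Ai {}Aj] x xf [_ /(_ _ _ ij)].
apply/negP; rewrite -ltNge.
rewrite -!xf in Ai Aj; apply: le_lt_trans (gdist_triangle _ _ (x0 i) _) _.
by rewrite gdist_sym (splitr d) ltrD// Ad.
Qed.

(** Each tuple of K^m has a neighbourhood on which some constant works, by one of
    the two previous lemmas; compactness of K^m yields a common constant. *)
Lemma interp_gauge_uniform_bound (K : set (hspace M)) (m : nat) (d : R) :
  compact K -> K `<=` sval U -> (0 < m)%N -> 0 < d -> exists2 C : R, 0 < C &
  forall x : 'I_m -> dom U, separated_tuples K d x ->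
  forall (r : 'rV[R]_m) (e : R), 0 <= e -> (forall i, `|r ord0 i| <= e) ->
    interp_gauge x r <= C * e.
Proof.
move=> cK KU m0 d0.
pose P (C : R) (f : forall _ : 'I_m, hspace M) :=
  forall x : 'I_m -> dom U, (forall i, inX (x i) = f i) ->
  separated_tuples K d x ->
  forall (r : 'rV[R]_m) (e : R), 0 <= e -> (forall i, `|r ord0 i| <= e) ->
    interp_gauge x r <= C * e.
have cKm := @tychonoff _ (fun _ : 'I_m => hspace M) (fun=> K) (fun=> cK).
have : \forall C \near +oo, [set f | forall i : 'I_m, K (f i)] `<=` P C.
  apply: (iffLR (compact_near_coveringP _) cKm) => f Kf.
  have /choice[x0 x0f] : forall i, exists x, @inX R M U x = f i.
    move=> i; have /KU := Kf i; have [_ <- _] := domA U.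
    by move=> [x _ <-]; exists x.
  have -> : f = (fun i => inX (x0 i)) by apply/funext => i; rewrite x0f.
  have [x0inj|x0inj] := pselect (injective x0).
    have [C CP] := near_interp_gauge m0 x0inj.
    near=> f' C'.
    have CC' : C <= C' by near: C'; apply: nbhs_pinfty_ge; exact: num_real.
    move=> x xf xsep r e e0 re.
    apply: (@le_trans _ _ (C * e)).
      by apply: (near CP f') => //; exact: separated_inj xsep.
    by rewrite ler_wpM2r.
  have nsep := near_not_separated K d0 x0inj.
  near=> f' C' => x xf xsep.
  by case: (near nsep f' _ x xf xsep).
move=> KP; near +oo_R => C; exists C => // x xsep.
by apply: (near KP C _ (fun i => inX (x i))) => //; exact: xsep.1.
Unshelve. all: end_near. Qed.

End UniformInterpolation.

(** * Functions defined by combinations *)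

(** Working with values instead of formulas lets the penalized minimum be built
    by closure properties. *)
Definition representable (R : realType) (M : har_structure R)
    (G : seq (lsort M)) (U : idx M) (m : nat) (x : 'I_m -> term G (Dom U))
    (Phi : formula m G) (F : env G -> R) :=
  exists2 psi, combination x Phi psi & forall e, sem psi e 0 = F e.

Section Representable.
Context (R : realType) (M : har_structure R) (G : seq (lsort M)) (U : idx M).
Context (m : nat) (x : 'I_m -> term G (Dom U)) (Phi : formula m G).
Local Notation rep := (representable x Phi).

Lemma representable_interp (r : 'rV[R]_m) :
  rep (fun e => interp_gauge (fun i => term_sem (x i) e) r).
Proof.
exists (FInterp x (fun i => FConst 0 G (r ord0 i))); first exact: comb_interp.
by move=> e /=; congr interp_gauge; apply/rowP => i; rewrite mxE.
Qed.

Lemma representable_eval (r : 'rV[R]_m) : rep (fun e => sem Phi e r).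
Proof.
exists (fill Phi (fun i => FConst 0 G (r ord0 i))); first exact: comb_eval.
by move=> e; rewrite sem_fill; congr sem; apply/rowP => i; rewrite mxE.
Qed.

Lemma representable_conn2 (c : R -> R -> R) (F1 F2 : env G -> R) :
  continuous (fun z : R * R => c z.1 z.2) -> rep F1 -> rep F2 ->
  rep (fun e => c (F1 e) (F2 e)).
Proof.
move=> cc [psi1 C1 E1] [psi2 C2 E2].
have cc' : continuous (fun v : 'rV[R]_2 => c (v ord0 ord0) (v ord0 ord_max)).
  move=> v; apply: (@continuous_comp _ _ _
    (fun v : 'rV[R]_2 => (v ord0 ord0, v ord0 ord_max))
    (fun z : R * R => c z.1 z.2)); last exact: cc.
  exact: (cvg_pair (@coord_continuous _ _ _ _ _ v) (@coord_continuous _ _ _ _ _ v)).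
exists (FConn cc' (fun i => if i == ord0 then psi1 else psi2)).
  by apply: comb_conn => i; case: ifP.
by move=> e /=; rewrite !mxE/= E1 E2.
Qed.

Lemma representable_conn1 (c : R -> R) (F : env G -> R) :
  continuous c -> rep F -> rep (fun e => c (F e)).
Proof.
move=> cc rF; apply: (@representable_conn2 (fun a _ => c a) F F) => //.
by move=> z; apply: continuous_comp; [exact: cvg_fst|exact: cc].
Qed.

Lemma representable_min (I : finType) (F0 : env G -> R) (F : I -> env G -> R) :
  rep F0 -> (forall i, rep (F i)) ->
  rep (fun e => \big[Num.min/F0 e]_i F i e).
Proof.
move=> r0 rF; elim: (index_enum I) => [|i s IH].
  by have [psi C E] := r0; exists psi => // e; rewrite big_nil E.
have [psi C E] : rep (fun e => Num.min (F i e) (\big[Num.min/F0 e]_(i <- s) F i e)).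
  apply: representable_conn2 => // z.
  by apply: continuous_min; [exact: cvg_fst|exact: cvg_snd].
by exists psi => // e; rewrite big_cons E.
Qed.

Lemma representable_penalized_min (s : R) (I : finType) (net : I -> 'rV[R]_m)
    (lambda rho : R) :
  rep (fun e => s * penalized_min net lambda rho
    (interp_gauge (fun i => term_sem (x i) e)) (fun r => s * sem Phi e r)).
Proof.
have rsem r : rep (fun e => s * sem Phi e r).
  by apply: (representable_conn1 _ (representable_eval r)); exact: mulrl_continuous.
apply: (@representable_conn1 ( *%R s)); first exact: mulrl_continuous.
apply: representable_min => // i.
apply: (@representable_conn2 (fun a b => a + lambda * Num.max 0 (b - rho))
  _ _ _ (rsem _) (representable_interp _)).
move=> z; apply: continuousD; first exact: cvg_fst.
apply: continuousM; first exact: cst_continuous.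
apply: continuous_max; first exact: cst_continuous.
by apply: continuousB; [exact: cvg_snd|exact: cst_continuous].
Qed.

End Representable.

(** The sign reduces the elimination of both quantifiers to that of infima. *)
Lemma quant_sem_sign (R : realType) (T : Type) (b : quantifier) (F : T -> R)
    (A : set T) :
  let s : R := if b is QInf then 1 else -1 in
  quant_sem b (F @` A) = s * inf ((fun t => s * F t) @` A).
Proof.
case: b => /=.
  by rewrite mul1r; congr (inf (_ @` _)); apply/funext => t; rewrite mul1r.
rewrite mulN1r /inf opprK image_comp; congr (sup (_ @` _)); apply/funext => t /=.
by rewrite mulN1r opprK.
Qed.

(** * Quantifier elimination *)

Lemma quantifier_approx (R : realType) (M : har_structure R)
    (U : idx M) (m : nat) (rho B C : R)
    (G : seq (lsort M)) (x : 'I_m -> term G (Dom U)) (Phi : formula m G)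
    (b : quantifier) (Z D : set (env G)) :
  harmonic_gauge_axioms M -> compatibility_axioms M ->
  0 < rho -> 0 < B -> 0 < C -> unif_cont_in_slots Phi Z -> D `<=` Z ->
  (forall e, D e -> let xe := fun i => term_sem (x i) e in
    [/\ forall r : 'rV[R]_m, exists h, ev xe h = r,
        forall i h, `|Eval (xe i) h| <= B * gauge (har_gm U) h &
        forall (r : 'rV[R]_m) (t : R), 0 <= t ->
          (forall i, `|r ord0 i| <= t) -> interp_gauge xe r <= C * t]) ->
  forall eps : R, 0 < eps -> exists2 psi, combination x Phi psi &
    forall e, D e ->
      `|sem psi e 0 - sem (FQuant b rho (at_evaluations x Phi)) e 0| < eps.
Proof.
move=> gaugeA compA rho0 B0 C0 Phi_cont DZ HD eps eps0.
pose box := B * rho; have box0 : 0 < box by rewrite mulr_gt0.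
have eps3 : 0 < eps / 3 by rewrite divr_gt0.
(* Continuity at scale 1 bounds the oscillation on the box, continuity at scale
   eps / 3 controls the rounding to the grid. *)
have [d1 d10 Phi1] := Phi_cont box 1 ltr01.
have [d d0 Phid] := Phi_cont box _ eps3.
pose N := (Num.truncn (box / d1)).+1.
have boxN : box < d1 * N%:R by rewrite mulrC -ltr_pdivrMr// truncnS_gt.
have N0 : (0 : R) < N%:R by rewrite ltr0n.
have [lambda [eta approx]] := inf_penalized_min m rho0 box0 C0 N0 d0 eps3.
pose s : R := if b is QInf then 1 else -1.
have s1 : `|s| = 1 by rewrite /s; case: (b); rewrite ?normrN normr1.
have [psi Cpsi psiE] := representable_penalized_min x Phi s
  (@box_grid R m box eta) lambda rho.
exists psi => // e De; have [surj evB qC] := HD e De.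
rewrite psiE sem_quant_at_evaluations quant_sem_sign -/s -mulrBr normrM s1 mul1r.
apply: (@le_lt_trans _ _ (2 * (eps / 3))); last lra.
apply: approx => //.
- exact: interp_gaugeZ.
- exact: interp_gaugeD.
- by exists 0; [rewrite /har_ball /= gauge0// ltW|exact: ev0].
- exact: interp_gauge_lt_eval_set.
- move=> r Er; have qr := eval_set_interp_gauge_le Er; split => // i.
  apply: (le_trans (le_interp_gauge surj r B0 (evB i))).
  by rewrite ler_pM2l.
- move=> r t rb tb rt; rewrite -mulrBr normrM s1 mul1r.
  by apply: Phid => //; exact: DZ.
- move=> r rb; rewrite -mulrBr normrM s1 mul1r.
  apply: (oscillation_le _ _ boxN rb); first exact: ltW.
  by move=> ? ? ? ? ?; apply: Phi1 => //; exact: DZ.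
Qed.

Lemma uniform_limit_on_approx (R : realType) (M : har_structure R)
    (G : seq (lsort M)) (D : set (env G)) (C : formula 0 G -> Prop)
    (phi : formula 0 G) :
  (forall eps : R, 0 < eps -> exists2 psi, C psi &
    forall e, D e -> `|sem psi e 0 - sem phi e 0| < eps) ->
  uniform_limit_on D C phi.
Proof.
move=> approx.
have /choice[psi psiP] : forall n : nat, exists psi, C psi /\
    forall e, D e -> `|sem psi e 0 - sem phi e 0| < n.+1%:R^-1.
  move=> n; have [|psi Cpsi H] := approx (n.+1%:R^-1); last by exists psi.
  by rewrite invr_gt0.
exists psi => [n|eps eps0]; first exact: (psiP n).1.
exists (Num.truncn eps^-1) => n Nn e De; apply: lt_le_trans ((psiP n).2 e De) _.
rewrite invf_ple ?posrE// ltW//; apply: lt_le_trans (truncnS_gt _) _.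
by rewrite ler_nat.
Qed.

Theorem theorem2p6 (R : realType) (M : har_structure R)
    (HM : is_BHS_model M) (HFI : finite_interpolation M)
    (U : idx M) (K : set (hspace M))
    (Kcompact : compact K) (KU : K `<=` sval U) (HEval : eval_uniform_on U K)
    (m : nat) (m_ge1 : (0 < m)%N)
    (delta : R) (delta_gt0 : 0 < delta) (rho : R) (rho_gt0 : 0 < rho) :
  [/\ (forall x : 'I_m -> dom U, separated_tuples K delta x ->
        [/\ [set r : 'rV[R]_m | interp_gauge x r < rho] `<=` eval_set rho x,
            eval_set rho x `<=` [set r | interp_gauge x r <= rho] &
            closure (eval_set rho x) = [set r | interp_gauge x r <= rho]]),
      (forall eps : R, 0 < eps -> exists2 t : R, t < rho &
        forall x : 'I_m -> dom U, separated_tuples K delta x ->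
        forall r : 'rV[R]_m, interp_gauge x r <= rho ->
        exists2 s : 'rV[R]_m, interp_gauge x s <= t &
          forall i, `|r ord0 i - s ord0 i| < eps) &
      (forall (G : seq (lsort M)) (x : 'I_m -> term G (Dom U))
              (Phi : formula m G) (b : quantifier) (Z : set (env G)),
        finite_evaluation (FQuant b rho (at_evaluations x Phi)) ->
        bounded_locus Z -> unif_cont_in_slots Phi Z ->
        uniform_limit_on
          [set e | Z e /\ separated_tuples K delta (fun i => term_sem (x i) e)]
          (combination x Phi)
          (FQuant b rho (at_evaluations x Phi)))].
Proof.
have [_ domA gaugeA compA [[Econt _ _ _] _ _]] := HM.
have [_ [B B0 EvalB]] := HEval.
have surj (x : 'I_m -> dom U) : separated_tuples K delta x ->
    forall r : 'rV[R]_m, exists h, ev x h = r.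
  by move=> /(separated_inj delta_gt0) xinj r; exact: HFI.
have [C C0 qC] := interp_gauge_uniform_bound domA gaugeA compA (Econt U) HFI
  Kcompact KU m_ge1 delta_gt0.
have dense (eps : R) : 0 < eps -> exists2 t : R, t < rho &
    forall x : 'I_m -> dom U, separated_tuples K delta x ->
    forall r : 'rV[R]_m, interp_gauge x r <= rho ->
    exists2 s : 'rV[R]_m, interp_gauge x s <= t &
      forall i, `|r ord0 i - s ord0 i| < eps.
  move=> eps0; have Brho0 : 0 < B * rho by rewrite mulr_gt0.
  have [kappa [t [kappa0 trho shrink]]] := shrink_into_ball rho_gt0 Brho0 eps0.
  exists t => // x xsep r qr; have xsurj := surj x xsep.
  have [i||s [? ? _]] := shrink m _ (interp_gaugeZ xsurj gaugeA compA) r.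
  - have evB h := EvalB _ h (xsep.1 i).
    by apply: (le_trans (le_interp_gauge xsurj r B0 evB)); rewrite ler_pM2l.
  - by rewrite (le_trans qr)// lerDl ltW.
  - by exists s.
split => // [x xsep|G x Phi b Z _ _ Phi_cont].
  have xsurj := surj x xsep; split.
  - exact: interp_gauge_lt_eval_set.
  - exact: eval_set_interp_gauge_le.
  - apply: (closure_eval_set xsurj (interp_gaugeD xsurj gaugeA compA) (qC x xsep) C0).
    move=> r eps /dense[t trho tP] /(tP x xsep)[s st rs].
    by exists s => //; exact: le_lt_trans trho.
apply: uniform_limit_on_approx.
apply: (quantifier_approx _ gaugeA compA rho_gt0 B0 C0 Phi_cont) => [e []//|e [_ xsep]].
by split; [exact: surj|move=> i h; exact/EvalB/xsep.1|exact: qC].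
Qed.
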